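(* Let $X$ be a normed space, $n>1$, $\Omega_1,\ldots,\Omega_n\subset X$ nonempty, $\widehat\Omega:=\Omega_1\times\cdots\times\Omega_n$, $\sigma_{\mathbf{x}}=\{\mathbf{x}^k\}\subset\widehat\Omega$, and $\sigma_{\mathbf{a}}=\{\mathbf{a}^k\}\subset X^n\setminus\{0\}$ with $\mathbf{a}^k\to0$. Let $\mathbf{u}^k\in\widehat\Omega$ $(k\in\mathbb{N})$, $\mathbf{u}^k-\mathbf{x}^k\to0$ as $k\to+\infty$, and $\sigma_{\mathbf{u}}:=\{\mathbf{u}^k\}$. Then $\rho(\sigma_{\mathbf{x}};\sigma_{\mathbf{a}})=\rho(\sigma_{\mathbf{u}};\sigma_{\mathbf{a}'})$, where $\sigma_{\mathbf{a}'}:=\{\mathbf{a}'^k\}$, $\mathbf{a}'^k:=\mathbf{a}^k+\mathbf{x}^k-\mathbf{u}^k$ $(k\in\mathbb{N})$, and $\widetilde\alpha(\sigma_{\mathbf{x}};\sigma_{\mathbf{a}})=\widetilde\alpha(\sigma_{\mathbf{u}};\sigma_{\mathbf{a}})$. As a consequence, $\{\Omega_1,\ldots,\Omega_n\}$ is extremal at $\sigma_{\mathbf{x}}$ with respect to $\sigma_{\mathbf{a}}$ if and only if it is extremal at $\sigma_{\mathbf{u}}$ with respect to $\sigma_{\mathbf{a}'}$; and it is approximately stationary at $\sigma_{\mathbf{x}}$ with respect to $\sigma_{\mathbf{a}}$ if and only if it is approximately stationary at $\sigma_{\mathbf{u}}$ with respect to $\sigma_{\mathbf{a}}$. In particular,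 if $\bar x\in\bigcap_{i=1}^n\Omega_i$ and $x_i^k\to\bar x$ as $k\to+\infty$ $(i=1,\ldots,n)$, where $\mathbf{x}^k=(x_1^k,\ldots,x_n^k)$, then $\{\Omega_1,\ldots,\Omega_n\}$ is extremal at $\bar x$ with respect to $\sigma_{\mathbf{a}}$ if and only if it is extremal at $\sigma_{\mathbf{x}}$ with respect to $\{\mathbf{a}'^k\}$, where now $\mathbf{a}'^k:=\mathbf{a}^k+(\bar x,\ldots,\bar x)-\mathbf{x}^k$ $(k\in\mathbb{N})$; and it is approximately stationary at $\bar x$ with respect to $\sigma_{\mathbf{a}}$ if and only if it is approximately stationary at $\sigma_{\mathbf{x}}$ with respect to $\sigma_{\mathbf{a}}$.
   Context: Notation. $X^n$ carries the maximum norm; $d(x,\emptyset)=+\infty$. For $\mathbf{x}=(x_1,\ldots,x_n)\in X^n$, $\zeta(\mathbf{x}):=d\big(0,\bigcap_{i=1}^n(\Omega_i-x_i)\big)$. For $c>0$, $c/0:=+\infty$ and $c/(+\infty):=0$. For $\sigma_{\mathbf{x}}=\{\mathbf{x}^k\}\subset\widehat\Omega$ and a sequence $\sigma_{\mathbf{a}}=\{\mathbf{a}^k\}\subset X^n$ with $\mathbf{a}^k\to0$, put $\rho(\sigma_{\mathbf{x}};\sigma_{\mathbf{a}}):=\liminf_{k\to+\infty}\zeta(\mathbf{x}^k+\mathbf{a}^k)$ and, if $\mathbf{a}^k\ne0$ for all $k$, $$\alpha(\sigma_{\mathbf{x}};\sigma_{\mathbf{a}}):=\limsup_{k\to+\infty}\frac{\|\mathbf{a}^k\|}{\zeta(\mathbf{x}^k+\mathbf{a}^k)},\qquad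 \widetilde\alpha(\sigma_{\mathbf{x}};\sigma_{\mathbf{a}}):=\inf\big\{\alpha(\sigma_{\mathbf{u}};\sigma_{\mathbf{a}})\mid \sigma_{\mathbf{u}}=\{\mathbf{u}^k\}\subset\widehat\Omega,\ \mathbf{u}^k-\mathbf{x}^k\to0\big\}.$$ The collection $\{\Omega_1,\ldots,\Omega_n\}$ is extremal at $\sigma_{\mathbf{x}}$ with respect to $\sigma_{\mathbf{a}}$ if $\rho(\sigma_{\mathbf{x}};\sigma_{\mathbf{a}})>0$ (in which case automatically $\mathbf{a}^k\neq0$ for all large $k$), and approximately stationary at $\sigma_{\mathbf{x}}$ with respect to $\sigma_{\mathbf{a}}$ if $\widetilde\alpha(\sigma_{\mathbf{x}};\sigma_{\mathbf{a}})=0$. For $\bar x\in\bigcap_i\Omega_i$, a property ''at $\bar x$ with respect to $\sigma_{\mathbf{a}}$'' means the property at the constant sequence $\mathbf{x}^k=(\bar x,\ldots,\bar x)$. *)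

(* Defs.v *)
From HB Require Import structures.
From mathcomp Require Import all_boot all_order all_algebra.
From mathcomp Require Import all_classical all_reals all_analysis.

Set Implicit Arguments.
Unset Strict Implicit.
Unset Printing Implicit Defensive.

Import Order.TTheory GRing.Theory Num.Theory.
Import numFieldNormedType.Exports.

Local Open Scope classical_set_scope.
Local Open Scope ring_scope.

(* [edist_inf A z] takes the infimum over [A] of [edist], which is defined from
   balls; in a normed module it is the usual distance d(z, A), with
   d(z, set0) = +oo. *)
Lemma edist_inf_normE (R : realType) (X : normedModType R) (A : set X) (z : X) :
  edist_inf A z = ereal_inf [set `|z - w|%:E | w in A].
Proof.
have edistE (w : X) : edist (z, w) = `|z - w|%:E.
  apply/eqP; rewrite eq_le; apply/andP; split; last first.
    apply: le_ereal_inf_tmp => _ [r [_ +] <-].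
    by rewrite /= -ball_normE /ball_ /= lee_fin => /ltW.
  apply/lee_addgt0Pr => e e0; rewrite -EFinD; apply: edist_fin => /=.
    by rewrite ltr_wpDl.
  by rewrite -ball_normE /ball_ /= ltrDl.
by rewrite /edist_inf; congr ereal_inf; apply: eq_imagel => w _; rewrite edistE.
Qed.

(* X^n is ['I_n -> X] with its pointwise group structure. *)

Definition maxnorm (R : realType) (X : normedModType R) (n : nat)
    (x : 'I_n -> X) : R :=
  \big[Num.max/0]_(i < n) `|x i|.

Definition vanishing (R : realType) (X : normedModType R) (n : nat)
    (z : nat -> 'I_n -> X) : Prop :=
  maxnorm (z k) @[k --> \oo] --> (0 : R).

Definition prodset (R : realType) (X : normedModType R) (n : nat)
    (Omega : 'I_n -> set X) : set ('I_n -> X) :=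
  [set x | forall i, Omega i (x i)].

Definition zeta (R : realType) (X : normedModType R) (n : nat)
    (Omega : 'I_n -> set X) (x : 'I_n -> X) : \bar R :=
  edist_inf (\bigcap_(i in [set: 'I_n]) [set w - x i | w in Omega i]) 0.

Definition rho (R : realType) (X : normedModType R) (n : nat)
    (Omega : 'I_n -> set X) (x a : nat -> 'I_n -> X) : \bar R :=
  limn_einf (fun k => zeta Omega (x k + a k)%R).

(* Only meaningful when a k != 0 for all k.  The extended-real division has
   c / 0 = +oo and c / +oo = 0 for c > 0. *)
Definition alpha (R : realType) (X : normedModType R) (n : nat)
    (Omega : 'I_n -> set X) (x a : nat -> 'I_n -> X) : \bar R :=
  limn_esup (fun k => ((maxnorm (a k))%:E / zeta Omega (x k + a k)%R)%E).

Definition talpha (R : realType) (X : normedModType R) (n : nat)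
    (Omega : 'I_n -> set X) (x a : nat -> 'I_n -> X) : \bar R :=
  ereal_inf [set alpha Omega u a | u in
    [set u : nat -> 'I_n -> X | (forall k, prodset Omega (u k)) /\
                                vanishing (fun k => u k - x k)%R]].

Definition extremal (R : realType) (X : normedModType R) (n : nat)
    (Omega : 'I_n -> set X) (x a : nat -> 'I_n -> X) : Prop :=
  (0 < rho Omega x a)%E.

Definition approx_stationary (R : realType) (X : normedModType R) (n : nat)
    (Omega : 'I_n -> set X) (x a : nat -> 'I_n -> X) : Prop :=
  talpha Omega x a = 0%E.

Definition extremal_at (R : realType) (X : normedModType R) (n : nat)
    (Omega : 'I_n -> set X) (xbar : X) (a : nat -> 'I_n -> X) : Prop :=
  extremal Omega (fun _ _ => xbar) a.

Definition approx_stationary_at (R : realType) (X : normedModType R) (n : nat)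
    (Omega : 'I_n -> set X) (xbar : X) (a : nat -> 'I_n -> X) : Prop :=
  approx_stationary Omega (fun _ _ => xbar) a.

(* Main.v *)
Require Import Defs.
From HB Require Import structures.
From mathcomp Require Import all_boot all_order all_algebra.
From mathcomp Require Import all_classical all_reals all_analysis.

Import Order.TTheory GRing.Theory Num.Theory.
Import numFieldNormedType.Exports.

Local Open Scope classical_set_scope.
Local Open Scope ring_scope.

(* rho depends only on the sums x k + a k, and x + a = u + a'.  The infimum
   defining talpha runs over all sequences in the product asymptotic to x, and
   being asymptotic is an equivalence relation. *)

(** Each coordinate norm is at most the maximum, and conversely a maximum over finitely many indices
    is small once every coordinate is. This lets limit rules in [X] be used coordinatewise in
    [X^n]. *)
Lemma vanishingP (R : realType) (X : normedModType R) (n : nat)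
    (z : nat -> 'I_n -> X) :
  vanishing z <-> forall i, z k i @[k --> \oo] --> (0 : X).
Proof.
split=> [z0 i|z0].
  apply/cvgr0Pnorm_lt => e e0.
  move/cvgr0Pnorm_lt: z0 => /(_ e e0); apply: filterS => k.
  by apply: le_lt_trans; apply: le_trans (ler_norm _); exact: le_bigmax_cond.
apply/cvgr0Pnorm_lt => e e0.
(* Finiteness of ['I_n] merges the thresholds of the coordinates into a single one. *)
have : \forall k \near \oo, forall i, `|z k i| < e.
  apply: filter_forall => i.
  by move/cvgr0Pnorm_lt: (z0 i); exact.
(* The maximum starts from [0]: it is therefore nonnegative, and bounding it by [e] also uses
   [0 < e]. *)
apply: filterS => k zke; rewrite ger0_norm; last exact: bigmax_ge_id.
by apply/bigmax_ltP; split.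
Qed.

Lemma vanishingD (R : realType) (X : normedModType R) (n : nat)
    (y z : nat -> 'I_n -> X) :
  vanishing y -> vanishing z -> vanishing (fun k => y k + z k).
Proof.
move=> /vanishingP y0 /vanishingP z0; apply/vanishingP => i.
by rewrite -[0 : X]addr0; exact: cvgD (y0 i) (z0 i).
Qed.

Lemma vanishingN (R : realType) (X : normedModType R) (n : nat)
    (z : nat -> 'I_n -> X) :
  vanishing z -> vanishing (fun k => - z k).
Proof.
move=> /vanishingP z0; apply/vanishingP => i.
by rewrite -[0 : X]oppr0; exact: cvgN (z0 i).
Qed.

(** The two sequences under the lower limit agree term by term, as [u k] cancels. *)
Lemma rho_shift (R : realType) (X : normedModType R) (n : nat)
    (Omega : 'I_n -> set X) (x u a : nat -> 'I_n -> X) :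
  rho Omega x a = rho Omega u (fun k => a k + x k - u k).
Proof.
by congr limn_einf; apply/funext => k; rewrite addrC [RHS]/= [in RHS]addrC subrK.
Qed.

(** Every competitor [v] for [u] is also one for [x], so the infimum at [x] runs over at least as
    many sequences. *)
Lemma le_talpha (R : realType) (X : normedModType R) (n : nat)
    (Omega : 'I_n -> set X) (x u a : nat -> 'I_n -> X) :
  vanishing (fun k => u k - x k) -> (talpha Omega x a <= talpha Omega u a)%E.
Proof.
move=> ux0; apply: ereal_inf_le_tmp => _ [v [vO vu0] <-]; exists v => //; split => //.
rewrite (_ : (fun k => _) = fun k => (v k - u k) + (u k - x k)).
  exact: vanishingD.
by apply/funext => k; rewrite addrA subrK.
Qed.

Lemma eq_talpha (R : realType) (X : normedModType R) (n : nat)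
    (Omega : 'I_n -> set X) (x u a : nat -> 'I_n -> X) :
  vanishing (fun k => u k - x k) -> talpha Omega x a = talpha Omega u a.
Proof.
(* One inequality follows from [ux0] directly; the other asks that [x k - u k] vanish, which is
   [ux0] negated. *)
move=> ux0; apply/eqP; rewrite eq_le !le_talpha//.
rewrite (_ : (fun k => _) = fun k => - (u k - x k)); first exact: vanishingN.
by apply/funext => k; rewrite opprB.
Qed.

Theorem proposition2p3 (R : realType) (X : normedModType R) (n : nat)
    (hn : (1 < n)%N)
    (Omega : 'I_n -> set X) (hOmega : forall i, Omega i !=set0)
    (x : nat -> 'I_n -> X) (hx : forall k, prodset Omega (x k))
    (a : nat -> 'I_n -> X) (ha : forall k, a k != 0) (ha0 : vanishing a) :
  (forall u : nat -> 'I_n -> X,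
      (forall k, prodset Omega (u k)) ->
      vanishing (fun k => u k - x k) ->
      let a' := fun k => a k + x k - u k in
      [/\ rho Omega x a = rho Omega u a',
          talpha Omega x a = talpha Omega u a,
          extremal Omega x a <-> extremal Omega u a' &
          approx_stationary Omega x a <-> approx_stationary Omega u a]) /\
  (forall xbar : X,
      (\bigcap_(i in [set: 'I_n]) Omega i) xbar ->
      (forall i, x k i @[k --> \oo] --> xbar) ->
      let a' := fun k => a k + (fun _ => xbar) - x k in
      (extremal_at Omega xbar a <-> extremal Omega x a') /\
      (approx_stationary_at Omega xbar a <-> approx_stationary Omega x a)).
Proof.
split=> [u _ ux0 a'|xbar _ xxbar a'].
  have Erho : rho Omega x a = rho Omega u a' by exact: rho_shift.
  have Etalpha : talpha Omega x a = talpha Omega u a by exact: eq_talpha.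
  by split; rewrite // /extremal /approx_stationary ?Erho ?Etalpha.
(* The constant sequence at [xbar] now takes the role of the base sequence, and [x] that of [u]. *)
have xx0 : vanishing (fun k => x k - (fun=> xbar)).
  apply/vanishingP => i; rewrite -(subrr xbar).
  by apply: cvgB (xxbar i) _; exact: cvg_cst.
rewrite /extremal_at /approx_stationary_at /extremal /approx_stationary.
by rewrite (rho_shift _ _ _ _ _ x) (eq_talpha _ _ _ _ _ x a xx0).
Qed.
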